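(* If $\mathbf A=(A,\le,\cdot,\sim,-)$ is a locally integral ipo-semigroup, then for every $p\in A^+$ the structure $\mathbf A_p=(A_p,\le,\cdot,1_p,\sim,-)$, where the relation and the operations are the restrictions to $A_p=\{y\in A:1_y=1_p\}$ of the corresponding relation and operations of $\mathbf A$, is an integral ipo-monoid. If in addition $\mathbf A$ is a semiring (that is, an involutive semiring), cyclic, or commutative, then every $\mathbf A_p$ is also a semiring (with binary joins and meets those of $\mathbf A$ restricted to $A_p$), cyclic, or commutative, respectively.
   Context: An ipo-semigroup is a structure $\mathbf A=(A,\le,\cdot,\sim,-)$ where $(A,\le)$ is a poset, $(A,\cdot)$ is a semigroup, and $\sim,-$ are order-reversing unary operations with $\sim{-}x=x=-{\sim}x$ and $xy\le z\iff y\cdot{\sim}z\le{\sim}x\iff -z\cdot x\le -y$ for all $x,y,z$. Its product is residuated, with residuals $z/y=-(y\cdot{\sim}z)$ and $x\backslash z={\sim}(-z\cdot x)$. An element $p$ is positive if $x\le px$ for all $x\in A$ (equivalently $x\le xp$ for all $x$); $A^+$ is the set of positive elements. $\mathbf A$ is locally integral if for all $x,y\in A$: $x\backslash x=x/x$ (this element is denoted $1_x$), $1_x\cdot x=x$, $y\le 1_xy$, $x\le 1_x$, and $x\backslash 1_x=1_x$. An integral ipo-monoid is a structure $(B,\le,\cdot,1,\sim,-)$ such that $(B,\le,\cdot,\sim,-)$ is an ipo-semigroup, $1\cdot x=x=x\cdot1$ for all $x$, and $1$ is the top element. An involutive semiring is an ipo-semigroup whose order is a lattice order (with $\wedge,\vee$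 regarded as operations). Cyclic means ${\sim}x=-x$ for all $x$; commutative means $xy=yx$ for all $x,y$. *)

(* Defs.v *)
From Stdlib Require Import Relation_Definitions.
From Corelib Require Import ssreflect ssrfun.

Set Implicit Arguments.
Unset Strict Implicit.
Unset Printing Implicit Defensive.

Declare Scope ipo_scope.
Delimit Scope ipo_scope with ipo.
Local Open Scope ipo_scope.

(** [til] is the operation written [∼] and [neg] the one written [-]. *)
Record ipo_signature : Type := IpoSignature {
  carrier :> Type;
  le : carrier -> carrier -> Prop;
  mul : carrier -> carrier -> carrier;
  til : carrier -> carrier;
  neg : carrier -> carrier
}.

Notation "x <= y" := (le x y) : ipo_scope.
Notation "x * y" := (mul x y) : ipo_scope.

Record ipo_semigroup (A : ipo_signature) : Prop := IpoSemigroup {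
  ipo_order : order A (@le A);
  ipo_mulA : associative (@mul A);
  ipo_til_anti : forall x y : A, x <= y -> til y <= til x;
  ipo_neg_anti : forall x y : A, x <= y -> neg y <= neg x;
  ipo_negK : forall x : A, til (neg x) = x;
  ipo_tilK : forall x : A, neg (til x) = x;
  ipo_mul_til : forall x y z : A, x * y <= z <-> y * til z <= til x;
  ipo_mul_neg : forall x y z : A, x * y <= z <-> neg z * x <= neg y
}.

Section Notions.

Variable A : ipo_signature.
Implicit Types x y z p : A.

(** The residuals [x\z] and [z/y]. *)
Definition lres x z : A := til (neg z * x).
Definition rres z y : A := neg (y * til z).

(** The element [1_x]; local integrality demands [x\x = x/x], so that the choice
    of residual is immaterial there. *)
Definition loc_one x : A := lres x x.

Definition positive p : Prop := forall x, x <= p * x.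

Record locally_integral : Prop := LocallyIntegral {
  li_res : forall x, lres x x = rres x x;
  li_one_mul : forall x, loc_one x * x = x;
  li_le_one_mul : forall x y, y <= loc_one x * y;
  li_le_one : forall x, x <= loc_one x;
  li_lres_one : forall x, lres x (loc_one x) = loc_one x
}.

Definition cyclic : Prop := forall x, til x = neg x.

Record integral_ipo_monoid (e : A) : Prop := IntegralIpoMonoid {
  iim_ipo : ipo_semigroup A;
  iim_mul1l : left_id e (@mul A);
  iim_mul1r : right_id e (@mul A);
  iim_top : forall x, x <= e
}.

Record involutive_semiring (meet join : A -> A -> A) : Prop :=
  InvolutiveSemiring {
  isr_ipo : ipo_semigroup A;
  isr_meet_lel : forall x y, meet x y <= x;
  isr_meet_ler : forall x y, meet x y <= y;
  isr_meet_glb : forall x y z, z <= x -> z <= y -> z <= meet x y;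
  isr_join_gel : forall x y, x <= join x y;
  isr_join_ger : forall x y, y <= join x y;
  isr_join_lub : forall x y z, x <= z -> y <= z -> join x y <= z
}.

End Notions.

Section Restriction.

Variables (T : Type) (P : T -> Prop).

Definition closed1 (f : T -> T) : Prop := forall x, P x -> P (f x).
Definition closed2 (f : T -> T -> T) : Prop :=
  forall x y, P x -> P y -> P (f x y).

Definition restrict1 (f : T -> T) (cf : closed1 f) (x : sig P) : sig P :=
  exist P (f (proj1_sig x)) (cf _ (proj2_sig x)).

Definition restrict2 (f : T -> T -> T) (cf : closed2 f) (x y : sig P) : sig P :=
  exist P (f (proj1_sig x) (proj1_sig y))
    (cf _ _ (proj2_sig x) (proj2_sig y)).

End Restriction.

Section Component.

Variables (A : ipo_signature) (p : A).

Definition in_component (y : A) : Prop := loc_one y = loc_one p.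

Record component_closed : Prop := ComponentClosed {
  cc_mul : closed2 in_component (@mul A);
  cc_til : closed1 in_component (@til A);
  cc_neg : closed1 in_component (@neg A);
  cc_one : in_component (loc_one p)
}.

(** The operations of [A] restrict to [A_p] only once closure is known, hence
    the argument [cc]. *)
Definition component (cc : component_closed) : ipo_signature :=
  @IpoSignature (sig in_component)
    (fun x y => proj1_sig x <= proj1_sig y)
    (restrict2 (cc_mul cc))
    (restrict1 (cc_til cc))
    (restrict1 (cc_neg cc)).

Definition component_one (cc : component_closed) : component cc :=
  exist in_component (loc_one p) (cc_one cc).

End Component.

(* Main.v *)
(** Two elements have the same local unit as soon as the same [z] lie below both
    units, and [z <= 1_x] can be read as [x z <= x] or as [z x <= x].  As
    [z x <= x] is equivalent to [-x z <= -x], negations preserve the unit.  If [x]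
    has unit [e], then [x w <= e] iff [w <= e], since [x\e = e]; cancelling factors
    in this way bounds the units of products and joins by [e], and meets follow by
    De Morgan. *)
Require Import Defs.
From Corelib Require Import ssreflect ssrfun.
From Stdlib Require Import Relation_Definitions Setoid ProofIrrelevance.

Local Open Scope ipo_scope.

(** Membership in a component is an equation in an arbitrary carrier, so uniqueness of its proofs is
    taken from the proof irrelevance axiom. *)
Lemma sig_inj (T : Type) (P : T -> Prop) (u v : sig P) :
  proj1_sig u = proj1_sig v -> u = v.
Proof. by apply: eq_sig_hprop => x; apply: proof_irrelevance. Qed.

Section IpoSemigroup.

Variable A : ipo_signature.
Hypothesis hA : ipo_semigroup A.
Implicit Types x y z p : A.

Lemma le_refl x : x <= x.
Proof. exact: (ord_refl _ _ (ipo_order hA)). Qed.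

Lemma le_trans y x z : x <= y -> y <= z -> x <= z.
Proof. exact: (ord_trans _ _ (ipo_order hA)). Qed.

Lemma le_antisym x y : x <= y -> y <= x -> x = y.
Proof. exact: (ord_antisym _ _ (ipo_order hA)). Qed.

Lemma le_ext x y : (forall z, z <= x <-> z <= y) -> x = y.
Proof. by move=> h; apply: le_antisym; apply/h; apply: le_refl. Qed.

(** After rotation by [ipo_mul_neg], the two sides differ only by the mutually inverse antitone maps
    [til] and [neg]. *)
Lemma le_lres x y z : y <= lres x z <-> x * y <= z.
Proof.
rewrite (ipo_mul_neg hA) /lres; split=> [/(ipo_neg_anti hA)|/(ipo_til_anti hA)].
  by rewrite (ipo_tilK hA).
by rewrite (ipo_negK hA).
Qed.

Lemma le_rres x y z : x <= rres z y <-> x * y <= z.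
Proof.
rewrite (ipo_mul_til hA) /rres; split=> [/(ipo_til_anti hA)|/(ipo_neg_anti hA)].
  by rewrite (ipo_negK hA).
by rewrite (ipo_tilK hA).
Qed.

Lemma mul_monol z x y : x <= y -> x * z <= y * z.
Proof. by move=> xy; apply/le_rres; apply: le_trans xy _; apply/le_rres/le_refl. Qed.

Lemma mul_monor z x y : x <= y -> z * x <= z * y.
Proof. by move=> xy; apply/le_lres; apply: le_trans xy _; apply/le_lres/le_refl. Qed.

(** Rotating [x * p <= x * p] gives [p * til (x * p) <= til x]. Left positivity puts [til (x * p)]
    below the left side, and [neg] turns the resulting inequality around. *)
Lemma positive_le_mulr p : positive p -> forall x, x <= x * p.
Proof.
move=> pp x.
have /(ipo_mul_til hA) h := le_refl (x * p).
have := ipo_neg_anti hA (le_trans _ _ _ (pp _) h).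
by rewrite !(ipo_tilK hA).
Qed.

Lemma meet_negjoin meet join x y : @involutive_semiring A meet join ->
  meet x y = til (join (neg x) (neg y)).
Proof.
move=> h; apply: le_antisym.
  rewrite -[meet x y](ipo_negK hA); apply: (ipo_til_anti hA).
  by apply: (isr_join_lub h); apply: (ipo_neg_anti hA);
    [apply: (isr_meet_lel h) | apply: (isr_meet_ler h)].
apply: (isr_meet_glb h).
  by rewrite -[X in _ <= X](ipo_negK hA); apply/(ipo_til_anti hA)/(isr_join_gel h).
by rewrite -[X in _ <= X](ipo_negK hA); apply/(ipo_til_anti hA)/(isr_join_ger h).
Qed.

Section LocallyIntegral.

Hypothesis hli : locally_integral A.

Lemma le_onel x z : z <= loc_one x <-> x * z <= x.
Proof. exact: le_lres. Qed.

Lemma le_oner x z : z <= loc_one x <-> z * x <= x.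
Proof. by rewrite /loc_one (li_res hli); apply: le_rres. Qed.

Lemma mul_one x : x * loc_one x = x.
Proof.
apply: le_antisym; first by apply/le_onel/le_refl.
(* The axiom [li_le_one_mul] says that [loc_one x] is positive. *)
exact: (positive_le_mulr _ (li_le_one_mul hli x)).
Qed.

Lemma mul_le_one x z : x * z <= loc_one x <-> z <= loc_one x.
Proof. by rewrite -{2}(li_lres_one hli x) le_lres. Qed.

Lemma loc_one_one x : loc_one (loc_one x) = loc_one x.
Proof.
(* The goal becomes [loc_one x * (z * x) <= x <-> z * x <= x]; one direction uses positivity of
   [loc_one x], the other [loc_one x * x = x]. *)
apply: le_ext => z; rewrite le_onel !le_oner -(ipo_mulA hA); split=> h.
  exact: le_trans (li_le_one_mul hli x _) h.
by rewrite -[X in _ <= X](li_one_mul hli); apply: mul_monor.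
Qed.

Lemma loc_one_neg x : loc_one (neg x) = loc_one x.
Proof. by apply: le_ext => z; rewrite le_onel le_oner -(ipo_mul_neg hA). Qed.

Lemma loc_one_til x : loc_one (til x) = loc_one x.
Proof. by rewrite -(loc_one_neg (til x)) (ipo_tilK hA). Qed.

Lemma loc_one_mul x y : loc_one x = loc_one y -> loc_one (x * y) = loc_one y.
Proof.
move=> xy; apply: le_ext => z; split=> h.
  (* Prefixing [y] and then [x] does not affect being below the common unit, so it is enough to
     bound [x * y * z], which [h] puts below [x * y]. *)
  rewrite -mul_le_one -xy -mul_le_one (ipo_mulA hA).
  apply: (le_trans (x * y)); first exact/le_onel.
  by apply/mul_le_one; rewrite xy; apply: (li_le_one hli).
apply/le_oner; rewrite (ipo_mulA hA); apply: mul_monol.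
by apply/le_oner; rewrite xy.
Qed.

Lemma loc_one_join meet join x y : @involutive_semiring A meet join ->
  loc_one x = loc_one y -> loc_one (join x y) = loc_one y.
Proof.
move=> h xy; apply: le_ext => z; split=> hz.
  rewrite -mul_le_one; apply: (le_trans (join x y * z)).
    exact: mul_monol (isr_join_ger h _ _).
  apply: (le_trans (join x y)); first exact/le_onel.
  apply: (isr_join_lub h); last exact: (li_le_one hli).
  by rewrite -xy; apply: (li_le_one hli).
(* Left multiplication by [z] is residuated, so it suffices to bound [z * x] and [z * y] by the
   join. *)
apply/le_oner/le_lres/(isr_join_lub h); apply/le_lres.
  by apply: (le_trans x); [apply/le_oner; rewrite xy | apply: (isr_join_gel h)].
by apply: (le_trans y); [apply/le_oner | apply: (isr_join_ger h)].
Qed.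

Lemma loc_one_meet meet join x y : @involutive_semiring A meet join ->
  loc_one x = loc_one y -> loc_one (meet x y) = loc_one y.
Proof.
move=> h xy; rewrite (meet_negjoin _ _ _ _ h) loc_one_til -(loc_one_neg y).
by apply: (loc_one_join _ _ _ _ h); rewrite !loc_one_neg.
Qed.

Lemma component_closedP p : component_closed p.
Proof.
split.
- by move=> x y px py; rewrite /in_component loc_one_mul // px py.
- by move=> x px; rewrite /in_component loc_one_til.
- by move=> x px; rewrite /in_component loc_one_neg.
- exact: loc_one_one.
Qed.

End LocallyIntegral.

(** The axioms are universally quantified, so they pass to a subset closed under the operations. *)
Lemma component_ipo p (cc : component_closed p) : ipo_semigroup (component cc).
Proof.
split.
- split=> [u|u v w|u v uv vu].
  + exact: le_refl.
  + exact: le_trans.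
  + exact/sig_inj/le_antisym.
- by move=> u v w; apply/sig_inj/(ipo_mulA hA).
- by move=> u v; apply: (ipo_til_anti hA).
- by move=> u v; apply: (ipo_neg_anti hA).
- by move=> u; apply/sig_inj/(ipo_negK hA).
- by move=> u; apply/sig_inj/(ipo_tilK hA).
- by move=> u v w; apply: (ipo_mul_til hA).
- by move=> u v w; apply: (ipo_mul_neg hA).
Qed.

(** Each member [x] of the component has [loc_one p] as its own local unit, so the laws reduce to
    those relating [x] to [loc_one x]. *)
Lemma component_monoid p (cc : component_closed p) :
  locally_integral A -> integral_ipo_monoid (component_one cc).
Proof.
move=> hli; split; first exact: component_ipo.
- by case=> x px; apply: sig_inj; rewrite /= -px; apply: (li_one_mul hli).
- by case=> x px; apply: sig_inj; rewrite /= -px; apply: mul_one.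
- by case=> x px; rewrite /= -px; apply: (li_le_one hli).
Qed.

Lemma component_semiring p (cc : component_closed p) meet join
    (cmeet : closed2 (in_component p) meet)
    (cjoin : closed2 (in_component p) join) :
  @involutive_semiring A meet join ->
  @involutive_semiring (component cc) (restrict2 cmeet) (restrict2 cjoin).
Proof.
move=> h; split; first exact: component_ipo.
- by move=> u v; apply: (isr_meet_lel h).
- by move=> u v; apply: (isr_meet_ler h).
- by move=> u v w; apply: (isr_meet_glb h).
- by move=> u v; apply: (isr_join_gel h).
- by move=> u v; apply: (isr_join_ger h).
- by move=> u v w; apply: (isr_join_lub h).
Qed.

End IpoSemigroup.

Theorem proposition3p14 (A : ipo_signature)
    (hA : ipo_semigroup A) (hli : locally_integral A)
    (p : A) (hp : positive p) :
  exists cc : component_closed p,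
    integral_ipo_monoid (component_one cc) /\
    (forall meet join : A -> A -> A,
       involutive_semiring meet join ->
       exists (cmeet : closed2 (in_component p) meet)
              (cjoin : closed2 (in_component p) join),
         @involutive_semiring (component cc)
           (restrict2 cmeet) (restrict2 cjoin)) /\
    (cyclic A -> cyclic (component cc)) /\
    (commutative (@mul A) -> commutative (@mul (component cc))).
Proof.
exists (component_closedP _ hA hli p); split; first exact: component_monoid.
split.
  move=> meet join h.
  have cmeet : closed2 (in_component p) meet.
    move=> x y px py; rewrite /in_component.
    by rewrite (loc_one_meet _ hA hli _ _ _ _ h) // px py.
  have cjoin : closed2 (in_component p) join.
    move=> x y px py; rewrite /in_component.
    by rewrite (loc_one_join _ hA hli _ _ _ _ h) // px py.
  by exists cmeet, cjoin; apply: component_semiring.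
(* Cyclicity and commutativity are equations, hence inherited through the injective projection to
   [A]. *)
by split=> h u => [|v]; apply/sig_inj/h.
Qed.
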